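(* The class of countable discrete groups with property A is closed under semidirect products, and in particular under direct products. That is, if $K$ and $H$ are countable discrete groups with property A and $H$ acts on $K$ by automorphisms, then the semidirect product $K\rtimes H$ has property A; in particular $K\times H$ has property A.
   Context: Property A: a discrete metric space $(X,d)$ has property A if for all $R,\epsilon>0$ there exists a family $\{A_x\}_{x\in X}$ of finite, non-empty subsets of $X\times\mathbb{N}$ such that (i) for all $x,y\in X$ with $d(x,y)\le R$ we have $\frac{|A_x\triangle A_y|}{|A_x\cap A_y|}<\epsilon$; (ii) there exists $S$ such that for each $x\in X$, if $(y,n)\in A_x$ then $d(x,y)\le S$. Groups as metric spaces: a discrete metric space $X$ has bounded geometry if for all $r>0$ there is $N_r$ with $|B(x,r)|<N_r$ for all $x\in X$. Every countable discrete group $G$ admits a left-invariant metric ($d(hg,hg')=d(g,g')$) of bounded geometry, and any two such metrics are coarsely equivalent via the identity map. A countable discrete group is said to have property A if it has property A as a metric space with respect to some (equivalently, every) left-invariant bounded geometry metric. *)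

(* Defs.v *)
From HB Require Import structures.
From mathcomp Require Import all_boot all_order all_algebra finmap.
From mathcomp Require Import all_classical all_reals all_analysis.

Set Implicit Arguments.
Unset Strict Implicit.
Unset Printing Implicit Defensive.

Import Order.TTheory GRing.Theory Num.Theory.

(* An action of H on K by group endomorphisms; autact1 and autactM make        *)
(* each map an automorphism (see autAction_bij), so this is the same thing as  *)
(* a homomorphism from H to Aut(K).                                            *)
Record autAction (H K : groupType) := AutAction {
  autact :> H -> K -> K;
  autact1 : forall k, autact 1%g k = k;
  autactM : forall h h' k, autact (h * h')%g k = autact h (autact h' k);
  autactMr : forall h, {morph autact h : k k' / (k * k')%g}
}.

Lemma autAction_bij (H K : groupType) (phi : autAction H K) (h : H) :
  bijective (phi h).
Proof.
by exists (phi h^-1%g) => k; rewrite -autactM ?mulVg ?mulgV autact1.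
Qed.

(* The alias carries phi, which determines the group law on K * H.             *)
Definition semidirect_prod (H K : groupType) (phi : autAction H K) : Type :=
  (K * H)%type.

Section SemidirectProduct.
Variables (H K : groupType) (phi : autAction H K).
Local Open Scope group_scope.
Local Notation semidirect := (semidirect_prod phi).

HB.instance Definition _ := Choice.copy semidirect (K * H)%type.

Definition semidirect_one : semidirect := (1, 1).
Definition semidirect_inv (x : semidirect) : semidirect :=
  (phi x.2^-1 x.1^-1, x.2^-1).
Definition semidirect_mul (x y : semidirect) : semidirect :=
  (x.1 * phi x.2 y.1, x.2 * y.2).

Fact autact_one h : phi h 1 = 1.
Proof. by apply: (mulgI (phi h 1)); rewrite -autactMr !mulg1. Qed.

Fact semidirect_mulA : associative semidirect_mul.
Proof.
by move=> x y z; rewrite /semidirect_mul /= autactMr autactM !mulgA.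
Qed.

Fact semidirect_mul1 : left_id semidirect_one semidirect_mul.
Proof. by case=> k h; rewrite /semidirect_mul /= autact1 !mul1g. Qed.

Fact semidirect_mulr1 : right_id semidirect_one semidirect_mul.
Proof. by case=> k h; rewrite /semidirect_mul /= autact_one !mulg1. Qed.

Fact semidirect_mulV :
  left_inverse semidirect_one semidirect_inv semidirect_mul.
Proof.
by case=> k h; rewrite /semidirect_mul /= -autactMr !mulVg autact_one.
Qed.

Fact semidirect_mulrV :
  right_inverse semidirect_one semidirect_inv semidirect_mul.
Proof.
by case=> k h; rewrite /semidirect_mul /= -autactM !mulgV autact1 mulgV.
Qed.

HB.instance Definition _ := isGroup.Build semidirect
  semidirect_mulA semidirect_mul1 semidirect_mulr1
  semidirect_mulV semidirect_mulrV.

End SemidirectProduct.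

Local Open Scope fset_scope.
Local Open Scope classical_set_scope.
Local Open Scope ring_scope.

Definition discrete_metric_space (R : realType) (X : metricType R) : Prop :=
  forall x : X, nbhs x = principal_filter x.

Definition fsymdiff (T : choiceType) (A B : {fset T}) : {fset T} :=
  ((A `\` B) `|` (B `\` A))%fset.

(* The conjunct (A x `&` A y)%fset != fset0 is needed because in MathComp      *)
(* division by 0 yields 0, whereas |A x /_\ A y| / 0 must not count as small.  *)
Definition property_A (R : realType) (X : metricType R) : Prop :=
  forall r e : R, 0 < r -> 0 < e ->
  exists A : X -> {fset X * nat},
    [/\ forall x, A x != fset0,
        forall x y, mdist x y <= r ->
          (A x `&` A y)%fset != fset0 /\
          #|` fsymdiff (A x) (A y)|%:R / #|` (A x `&` A y)%fset|%:R < e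
      & exists S : R, forall x y n, (y, n) \in A x -> mdist x y <= S].

Definition bounded_geometry (R : realType) (X : metricType R) : Prop :=
  forall r : R, 0 < r -> exists N : nat, forall x : X,
    finite_set (ball x r) /\ (#|` fset_set (ball x r)| < N)%N.

(* The type of metrics on the carrier of T; its inhabitants are obtained with  *)
(* isMetric.Build.                                                             *)
Definition metric_on (R : realType) (T : choiceType) : Type :=
  isMetric.axioms_ R T (Choice.class T) (Choice.class T).

Definition metric_space_of (R : realType) (T : choiceType)
    (d : metric_on R T) : metricType R :=
  let d' : isMetric.axioms_ R T (Choice.class T) (Choice.class T) := d in
  HB.pack (Choice.sort T) d'.

Definition left_invariant (R : realType) (G : groupType) (d : metric_on R G) :
  Prop := forall h g g' : G,
  isMetric.mdist d (h * g)%g (h * g')%g = isMetric.mdist d g g'.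

Definition group_property_A (R : realType) (G : groupType) : Prop :=
  countable [set: G] /\
  exists d : metric_on R G,
    [/\ left_invariant d, discrete_metric_space (metric_space_of d),
        bounded_geometry (metric_space_of d) & property_A (metric_space_of d)].

(* Main.v *)
Require Import Defs.
From mathcomp Require Import all_boot all_algebra all_classical all_reals.
From mathcomp Require Import all_order finmap all_analysis lra.

(* Property A of a countable group is rephrased without a metric and with      *)
(* real weights: for every finite set F of displacements there is a finite S   *)
(* and, for each x, a measure of mass at most 1 supported in x S, such that    *)
(* the measures at x and x t have common mass (the sum of their pointwise      *)
(* minima) at least 1 - e for every t in F.  Normalised counting measures give *)
(* one direction; conversely, the weights are multiplied by a large integer M  *)
(* and rounded down, which loses at most |S| of the common mass M (1 - e).     *)
(* In a semidirect product the measures are multiplied: from k h, first move h *)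
(* to h' with the H-weights, then move inside the coset h' K = K h' with the   *)
(* K-weights of phi_(h'^-1)(k).  This preserves large common mass because      *)
(* min(a b, a' b') >= min(a, a') min(b, b') for nonnegative weights.           *)

(** The weighted form [reiter_A] sees only the group law, so [reiter_A_semidirect] compares no
    metrics on [K], [H] and the product. [group_property_A_reiter] extracts weights from a given
    metric. The way back, [reiter_A_group_property_A], must supply a metric on the product:
    exhausting a countable group by finite symmetric sets [length_ball] yields a length [len] with
    finite balls, hence a left-invariant one. *)

Set Implicit Arguments.
Unset Strict Implicit.
Unset Printing Implicit Defensive.

Import Order.TTheory GRing.Theory Num.Theory.

Local Open Scope fset_scope.
Local Open Scope ring_scope.

(* [f x s] is the mass at the point [x * s] of the measure attached to [x];    *)
(* the last sum is the common mass of the measures attached to [x], [x * t].   *)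
Definition reiter_A (R : realType) (G : groupType) : Prop :=
  forall (F : {fset G}) (e : R), 0 < e ->
  exists (f : G -> G -> R) (S : {fset G}),
    [/\ forall x s, 0 <= f x s,
        forall x s, s \notin S -> f x s = 0,
        forall x, \sum_(s <- S) f x s <= 1
      & forall x t, t \in F ->
          1 - e <= \sum_(s <- S) Num.min (f x s) (f (x * t)%g (t^-1 * s)%g)].

(** * A left-invariant metric with finite balls *)

Lemma countable_surjection (T : choiceType) (x0 : T) :
  countable [set: T] -> exists e : nat -> T, forall x, exists n, e n = x.
Proof.
case/countable_injP => g gI.
have gi : injective g by move=> x y; apply: gI; apply/mem_set.
exists (fun n =>
  if pselect (exists x, g x = n) is left h then sval (cid h) else x0).
move=> x; exists (g x); case: pselect => [h|[]]; last by exists x.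
by case: cid => /= y /gi.
Qed.

Section ProperLength.
Variables (G : groupType) (e : nat -> G).
Hypothesis eE : forall x, exists n, e n = x.

(* Squaring the ball at each step makes the balls satisfy                      *)
(* B_m B_n <= B_(max(m, n) + 1) <= B_(m + n) for m, n >= 1.                    *)
Fixpoint length_ball (n : nat) : {fset G} :=
  if n is m.+1 then
    [fset (a * b)%g | a in length_ball m, b in length_ball m]
      `|` [fset e m; (e m)^-1%g]
  else [fset 1%g].

Lemma in_length_ball0 g : (g \in length_ball 0) = (g == 1%g).
Proof. exact: in_fset1. Qed.

Lemma length_ball1 n : 1%g \in length_ball n.
Proof.
elim: n => [|n IHn] /=; first by rewrite in_length_ball0.
rewrite in_fsetU; apply/orP; left.
by apply/imfset2P; exists 1%g => //; exists 1%g; rewrite ?mulg1.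
Qed.

Lemma length_ballMS n g h : g \in length_ball n -> h \in length_ball n ->
  (g * h)%g \in length_ball n.+1.
Proof.
move=> gn hn /=; rewrite in_fsetU; apply/orP; left.
by apply/imfset2P; exists g => //; exists h.
Qed.

Lemma length_ball_mono m n g : (m <= n)%N ->
  g \in length_ball m -> g \in length_ball n.
Proof.
move=> /subnK <-; elim: (n - m)%N => // k IHk /IHk gk.
by rewrite -[g]mulg1 addSn length_ballMS ?length_ball1.
Qed.

Lemma length_ballM m n g h : g \in length_ball m -> h \in length_ball n ->
  (g * h)%g \in length_ball (m + n).
Proof.
case: m => [|m]; first by rewrite in_length_ball0 => /eqP ->; rewrite mul1g.
case: n => [|n] gm; first by
  rewrite in_length_ball0 addn0 => /eqP ->; rewrite mulg1.
move=> hn; apply: (@length_ball_mono (m + n).+2); first by rewrite addnS.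
by apply: length_ballMS; [move: gm | move: hn]; apply: length_ball_mono;
  rewrite ltnS ?leq_addr ?leq_addl.
Qed.

Lemma length_ballV n g : g \in length_ball n -> g^-1%g \in length_ball n.
Proof.
elim: n g => [g|n IHn g].
  by rewrite !in_length_ball0 => /eqP ->; rewrite invg1.
rewrite !in_fsetU => /orP[/imfset2P[a /= /IHn an [b /= /IHn bn ->]]|].
  by apply/orP; left; rewrite invgM; apply/imfset2P; exists b^-1%g => //;
    exists a^-1%g.
by rewrite !inE => /orP[]/eqP ->; rewrite ?invgK eqxx ?orbT.
Qed.

Lemma length_ball_cover g : exists n, g \in length_ball n.
Proof. by have [n <-] := eE g; exists n.+1; rewrite /= !inE eqxx orbT. Qed.

Definition len (g : G) : nat := ex_minn (length_ball_cover g).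

Lemma len_le g n : (len g <= n)%N = (g \in length_ball n).
Proof.
rewrite /len; case: ex_minnP => m gm minm.
by apply/idP/idP => [/length_ball_mono|]; [apply | exact: minm].
Qed.

Lemma len_eq0 g : (len g == 0)%N = (g == 1%g).
Proof. by rewrite -leqn0 len_le in_length_ball0. Qed.

Lemma lenV g : len g^-1%g = len g.
Proof.
apply/eqP; rewrite eqn_leq !len_le length_ballV; last by rewrite -len_le.
by rewrite -[g in g \in _]invgK length_ballV // -len_le.
Qed.

Lemma lenM g h : (len (g * h)%g <= len g + len h)%N.
Proof. by rewrite len_le length_ballM // -len_le. Qed.

Variable R : realType.

Definition len_dist (x y : G) : R := (len (x^-1 * y)%g)%:R.

Lemma len_distxx x : len_dist x x = 0.
Proof.
by apply/eqP; rewrite /len_dist mulVg pnatr_eq0 len_eq0.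
Qed.

Lemma len_dist_positivity x y : len_dist x y = 0 -> x = y.
Proof.
move/eqP; rewrite /len_dist pnatr_eq0 len_eq0 => /eqP xy.
by rewrite -[y](mulVKg x) xy mulg1.
Qed.

Lemma len_dist_sym x y : len_dist x y = len_dist y x.
Proof. by rewrite /len_dist -lenV invgM invgK. Qed.

Lemma len_dist_triangle y x z : len_dist x z <= len_dist x y + len_dist y z.
Proof.
rewrite /len_dist -natrD ler_nat; apply: leq_trans (lenM _ _).
by rewrite mulgA mulgK.
Qed.

Definition len_metric : metric_on R G :=
  isMetric.Build R G len_distxx len_dist_positivity len_dist_sym
    len_dist_triangle.

Lemma len_mdistE (x y : metric_space_of len_metric) :
  mdist x y = (len ((x : G)^-1 * (y : G))%g)%:R.
Proof. by []. Qed.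

Lemma len_metric_left_invariant : left_invariant len_metric.
Proof.
by move=> h g g'; rewrite /= /len_dist invgM -mulgA mulKg.
Qed.

Lemma len_metric_discrete : discrete_metric_space (metric_space_of len_metric).
Proof.
move=> x; apply/seteqP; split => A /=.
  by move=> xA; apply/principal_filterP; exact: nbhs_singleton.
move=> /principal_filterP Ax; apply: filterS (nbhsx_ballx x 1 ltr01) => y.
rewrite ballEmdist /= len_mdistE ltrn1 ltnS leqn0 len_eq0 => /eqP xy.
suff -> : y = x by [].
by rewrite -[y](mulVKg (x : G)) xy mulg1.
Qed.

Lemma len_le_truncn (r : R) g :
  (len g)%:R <= r -> g \in length_ball (Num.truncn r).
Proof.
by move=> gr; rewrite -len_le truncn_ge_nat // (le_trans _ gr).
Qed.

(** Each ball lies in a left translate of one finite [length_ball], so one bound serves all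
    centres. *)
Lemma len_metric_bounded_geometry :
  bounded_geometry (metric_space_of len_metric).
Proof.
move=> r r0; exists (#|` length_ball (Num.truncn r)|).+1 => x.
pose B : {fset G} := [fset ((x : G) * g)%g | g in length_ball (Num.truncn r)].
have xB : (ball x r `<=` [set` B])%classic.
  move=> y; rewrite ballEmdist /= len_mdistE => /ltW /len_le_truncn yr.
  by apply/imfsetP; exists ((x : G)^-1 * y)%g; rewrite ?mulVKg.
have fB : finite_set (ball x r) by exact: sub_finite_set xB (finite_fset B).
have cB : (#|` B| <= #|` length_ball (Num.truncn r)|)%N.
  by rewrite leq_imfset_card.
split=> //; rewrite ltnS; apply: leq_trans cB.
apply/fsubset_leq_card/fsubsetP => y; rewrite in_fset_set // => /set_mem.
exact: xB.
Qed.

End ProperLength.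

(** * Weights on a semidirect product *)

Section Semidirect.
Variables (R : realType) (K H : groupType) (phi : autAction H K).
Local Notation G := (semidirect_prod phi).

Lemma autactVK (h : H) : cancel (phi h) (phi h^-1%g).
Proof. by move=> k; rewrite -autactM mulVg autact1. Qed.

Lemma autactKV (h : H) : cancel (phi h^-1%g) (phi h).
Proof. by move=> k; rewrite -autactM mulgV autact1. Qed.

Lemma autactV (h : H) (k : K) : phi h k^-1%g = (phi h k)^-1%g.
Proof.
by apply: (mulIg (phi h k)); rewrite -autactMr !mulVg autact_one.
Qed.

Lemma reiter_A_semidirect : reiter_A R K -> reiter_A R H -> reiter_A R G.
Proof.
move=> hK hH F e e0.
(* Common masses multiply, and (1 - d)^2 >= 1 - 2 d >= 1 - e; the cap at 1 keeps 1 - d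
   nonnegative. *)
pose d := Num.min (e / 2) 1.
have [d0 de d1] : [/\ 0 < d, d <= e / 2 & d <= 1].
  by rewrite /d lt_min ltr01 divr_gt0 // !ge_min !lexx orbT.
have [fH [SH [fH0 fHS fH1 fHF]]] := hH [fset t.2 | t in F] d d0.
(* Seen from the coset reached by [s], the displacement [t] acts on the K-coordinate as right
   translation by [phi s^-1 t.1]. Only finitely many arise because [SH] is already fixed. *)
have [fK [SK [fK0 fKS fK1 fKF]]] :=
  hK [fset phi s^-1%g t.1 | s in SH, t in F] d d0.
(* The displacement a = s u with s = a.2 in H and u = phi_(s^-1) a.1 in K      *)
(* moves k h to h' phi_(h'^-1)(k) u, where h' = h s.                           *)
pose f (g a : G) :=
  fH g.2 a.2 * fK (phi (g.2 * a.2)^-1%g g.1) (phi a.2^-1%g a.1).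
pose S : {fset G} := [fset ((phi s u, s) : G) | s in SH, u in SK].
have sumS (E : G -> R) : \sum_(a <- S) E a =
    \sum_(s <- SH) \sum_(u <- SK) E (phi s u, s).
  rewrite /S big_imfset2 //= => -[s u] [s' u'] _ _ /= [+ ss'].
  by rewrite ss' => /(can_inj (autactVK _)) ->.
exists f, S; split.
- by move=> g a; rewrite mulr_ge0.
- move=> g [c s] aS; rewrite /f /=.
  have [sS|/fHS ->] := boolP (s \in SH); last by rewrite mul0r.
  rewrite fKS ?mulr0 //; apply: contra aS => uS.
  by apply/imfset2P; exists s => //; exists (phi s^-1%g c); rewrite ?autactKV.
- move=> g; rewrite sumS; apply: le_trans (fH1 g.2); apply: ler_sum => s _.
  under eq_bigr do rewrite /f /= autactVK.
  by rewrite -mulr_sumr ler_piMr.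
- move=> [k h] [a b] tF; rewrite sumS.
  apply: (@le_trans _ _ ((1 - d) * (1 - d))); first by nra.
  have tF2 : b \in [fset t.2 | t in F] by apply/imfsetP; exists (a, b).
  apply: (@le_trans _ _ (\sum_(s <- SH)
     Num.min (fH h s) (fH (h * b)%g (b^-1 * s)%g) * (1 - d))).
    by rewrite -mulr_suml ler_wpM2r ?subr_ge0 //; exact: fHF.
  rewrite !big_seq; apply: ler_sum => s sS.
  have tF1 : phi s^-1%g a \in [fset phi s^-1%g t.1 | s in SH, t in F].
    by apply/imfset2P; exists s => //; exists (a, b).
  apply: le_trans (ler_wpM2l _ (fKF (phi (h * s)^-1%g k) _ tF1)) _.
    by rewrite le_min !fH0.
  rewrite mulr_sumr; apply: ler_sum => u _.
  rewrite /f /= autactVK.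
  have -> : phi (h * b * (b^-1 * s))^-1%g (k * phi h a)%g =
            (phi (h * s)^-1 k * phi s^-1 a)%g.
    by rewrite -mulgA mulVKg autactMr -autactM invgM -mulgA mulVg mulg1.
  have -> : phi (b^-1 * s)^-1%g (phi b^-1 a^-1 * phi b^-1 (phi s u))%g =
            ((phi s^-1 a)^-1 * u)%g.
    rewrite -autactMr invgM invgK -autactM mulgK.
    by rewrite autactMr autactVK autactV.
  by rewrite le_min !ler_pM ?le_min ?fH0 ?fK0 ?ge_min ?lexx ?orbT.
Qed.

End Semidirect.

Definition trivial_action (H K : groupType) : autAction H K :=
  @AutAction H K (fun=> id) (fun=> erefl) (fun _ _ _ => erefl)
    (fun _ _ _ => erefl).

(* The group laws of the product and of the trivial semidirect product are     *)
(* convertible.                                                                *)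
Lemma reiter_A_prod (R : realType) (K H : groupType) :
  reiter_A R K -> reiter_A R H -> reiter_A R (K * H)%type.
Proof. exact: (@reiter_A_semidirect R K H (trivial_action H K)). Qed.

(** * From a metric to weights *)

Lemma leq_count_fsubset (T : choiceType) (a : pred T) (A B : {fset T}) :
  A `<=` B -> (count a A <= count a B)%N.
Proof.
move=> /fsubsetP AB; rewrite -!size_filter; apply: uniq_leq_size.
  by rewrite filter_uniq.
by move=> x; rewrite !mem_filter => /andP[-> /AB].
Qed.

Lemma sum_count_fibers (T U : choiceType) (h : T -> U) (A : seq T)
    (S : {fset U}) :
  (\sum_(s <- S) count (fun p => h p == s) A = count (fun p => h p \in S) A)%N.
Proof.
elim: A => [|p A IHA] /=; first by rewrite big1.
rewrite big_split /= IHA; congr addn.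
under eq_bigr do rewrite eq_sym.
rewrite -count_uniq_mem ?fset_uniq // -sum1_count [RHS]big_mkcond.
by apply: eq_bigr => s _ /=; case: (s == h p).
Qed.

Section MetricToReiter.
Variables (R : realType) (G : groupType).

Lemma group_property_A_reiter : group_property_A R G -> reiter_A R G.
Proof.
move=> [_ [d [dinv _ dbg dA]]] F e e0.
pose X := metric_space_of d.
have dE (x y : G) : @mdist R X x y = @mdist R X 1%g (x^-1 * y)%g.
  by have := dinv x^-1%g x y; rewrite mulVg.
(* The summand 1 keeps [r] positive when [F] is empty. *)
pose r : R := 1 + \sum_(t <- F) @mdist R X 1%g t.
have dF t : t \in F -> @mdist R X 1%g t <= r.
  move=> tF; rewrite /r (big_fsetD1 t) //= addrCA lerDl addr_ge0 //.
  by apply: sumr_ge0 => ? _; exact: mdist_ge0.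
have r0 : 0 < r by rewrite ltr_pwDl // sumr_ge0 // => ? _; exact: mdist_ge0.
have [A [A0 AF [S0 AS]]] := dA r e r0 e0.
(* [S0] may be negative, and [ball] is open while the bound is not strict. *)
have S1 : 0 < `|S0| + 1 by rewrite ltr_wpDl.
have [N /(_ (1%g : G)) [ballfin _]] := dbg _ S1.
pose S : {fset G} := fset_set (ball (1%g : X) (`|S0| + 1)).
have memS x p : p \in A x -> (x^-1 * p.1)%g \in S.
  case: p => y n /AS; rewrite dE => yS; rewrite /S in_fset_set //.
  apply/mem_set; rewrite ballEmdist /=; apply: le_lt_trans yS _.
  by rewrite (le_lt_trans (ler_norm _)) // ltrDl.
have cA x : (0 < #|` A x|%:R :> R) by rewrite ltr0n cardfs_gt0.
pose f (x s : G) : R :=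
  (count (fun p => (x^-1 * p.1)%g == s) (A x))%:R / #|` A x|%:R.
have fM (x s : G) (p : G * nat) (t : G) :
    (((x * t)^-1 * p.1)%g == (t^-1 * s)%g) = ((x^-1 * p.1)%g == s).
  by rewrite invgM -mulgA (inj_eq (mulgI _)).
exists f, S; split.
- by move=> x s; rewrite divr_ge0.
- move=> x s sS; rewrite /f (_ : count _ _ = 0)%N ?mul0r //.
  apply/eqP; rewrite -leqn0 leqNgt -has_count; apply/hasPn => p /memS pS.
  by apply: contra sS => /eqP <-.
- move=> x; rewrite -mulr_suml ler_pdivrMr // mul1r -natr_sum ler_nat.
  by rewrite sum_count_fibers count_size.
- move=> x t tF.
  have [I0] : A x `&` A (x * t)%g != fset0 /\
      #|` fsymdiff (A x) (A (x * t)%g)|%:R / #|` A x `&` A (x * t)%g|%:R < e.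
    by apply: AF; rewrite dE mulKg; exact: dF.
  set I := A x `&` A (x * t)%g in I0 *; set D := fsymdiff _ _.
  have I1 : (0 < #|` I|%:R :> R) by rewrite ltr0n cardfs_gt0.
  have ID : 0 < (#|` I| + #|` D|)%:R :> R.
    by rewrite ltr0n addn_gt0 cardfs_gt0 I0.
  rewrite ltr_pdivrMr // => DI.
  have cx : (#|` A x| <= #|` I| + #|` D|)%N.
    by rewrite -(cardfsID (A (x * t)%g)) leq_add2l fsubset_leq_card //
      fsubsetUl.
  have cy : (#|` A (x * t)%g| <= #|` I| + #|` D|)%N.
    by rewrite -(cardfsID (A x)) fsetIC leq_add2l fsubset_leq_card //
      fsubsetUr.
  (* Both sets have at most |I| + |D| points, so the common mass is at least |I| / (|I| + |D|),
     which is at least 1 - e since |D| < e |I|. *)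
  apply: (@le_trans _ _ (\sum_(s <- S)
     (count (fun p => (x^-1 * p.1)%g == s) I)%:R / (#|` I| + #|` D|)%:R)).
    rewrite -mulr_suml -natr_sum sum_count_fibers.
    rewrite (_ : count _ _ = #|` I|); last first.
      apply/eqP; rewrite -all_count; apply/allP => p.
      by rewrite inE => /andP[/memS].
    rewrite ler_pdivlMr //.
    have D0 : 0 <= #|` D|%:R :> R by [].
    by rewrite natrD; nra.
  apply: ler_sum => s _; rewrite le_min /f.
  under [X in _ && (_ <= X%:R / _)]eq_count do rewrite fM.
  by rewrite !ler_pM ?invr_ge0 // ?lef_pV2 ?posrE ?ler_nat ?leq_count_fsubset
    ?fsubsetIl ?fsubsetIr.
Qed.

End MetricToReiter.

(** * From weights to a metric *)

Lemma card_columns (T U : choiceType) (h : T -> U) (S : {fset T})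
    (c : T -> nat) : injective h ->
  #|` [fset q in [seq (h s, n) | s <- S, n <- iota 0 (c s)]]| =
  (\sum_(s <- S) c s)%N.
Proof.
move=> hI; rewrite card_fseq undup_id; last first.
  apply: allpairs_uniq_dep => //= [s _|]; first exact: iota_uniq.
  by move=> [s n] [s' n'] _ _ /= [/hI -> ->].
rewrite size_allpairs_dep sumnE big_map.
by apply: eq_bigr => s _; rewrite size_iota.
Qed.

Section ReiterToMetric.
Variables (R : realType) (G : groupType).

Lemma reiter_A_group_property_A :
  countable [set: G] -> reiter_A R G -> group_property_A R G.
Proof.
move=> cG GA; split=> //.
have [e eE] := countable_surjection 1%g cG.
exists (len_metric eE R); split.
- exact: len_metric_left_invariant.
- exact: len_metric_discrete.
- exact: len_metric_bounded_geometry.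
move=> r eps r0 eps0.
(* Chosen so that 4 d < eps (1 - 2 d).                                         *)
pose d := eps / (2 * (4 + 2 * eps)).
have den0 : 0 < 2 * (4 + 2 * eps) by rewrite mulr_gt0 // addr_gt0 // mulr_gt0.
have d0 : 0 < d by rewrite divr_gt0.
have dE : d * (2 * (4 + 2 * eps)) = eps by rewrite divfK // gt_eqF.
have d4 : 2 * d < 1 by nra.
have [f [S [f0 fS f1 fF]]] := GA (length_ball e (Num.truncn r)) d d0.
have [M [MS M0]] : exists M : nat, #|` S|%:R <= d * M%:R /\ 0 < M%:R :> R.
  exists (Num.truncn (#|` S|%:R / d)).+1; rewrite ltr0n; split=> //.
  by rewrite mulrC -ler_pdivrMr // ltW // truncnS_gt.
pose c x s : nat := Num.truncn (M%:R * f x s).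
(* Levels start at 0 over every point, so two columns over the same point meet in the shorter one:
   intersections count minima. *)
pose col x (k : G -> nat) : {fset G * nat} :=
  [fset q in [seq ((x * s)%g, n) | s <- S, n <- iota 0 (k s)]].
have colP x k z n : ((z, n) \in col x k) =
    ((x^-1 * z)%g \in S) && (n < k (x^-1 * z)%g)%N.
  rewrite /col in_fset.
  apply/allpairsPdep/andP => [[s [m [sS + [-> ->]]]]|[zS nk]].
    by rewrite mem_iota mulKg.
  by exists (x^-1 * z)%g, n; rewrite mulVKg mem_iota.
have card_col x k : #|` col x k| = (\sum_(s <- S) k s)%N.
  by apply: card_columns; exact: mulgI.
pose A x := col x (c x).
have cA x : #|` A x|%:R <= M%:R :> R.
  rewrite card_col natr_sum -[leRHS]mulr1.
  apply: le_trans (ler_wpM2l (ltW M0) (f1 x)); rewrite mulr_sumr.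
  by apply: ler_sum => s _; rewrite truncn_le mulr_ge0.
have AI x t : t \in length_ball e (Num.truncn r) ->
    M%:R * (1 - 2 * d) <= #|` A x `&` A (x * t)%g|%:R.
  move=> tF.
  pose k s := minn (c x s) (c (x * t)%g (t^-1 * s)%g).
  have sub : col x k `<=` A x `&` A (x * t)%g.
    apply/fsubsetP => -[z n]; rewrite colP in_fsetI !colP leq_min.
    case/and3P => -> -> /=; rewrite invgM -mulgA => nc; rewrite nc andbT.
    (* Outside [S] the height is 0, so no level [n] lies below it. *)
    apply: contraTT nc => /fS fS0.
    by rewrite /c fS0 mulr0 truncn0.
  apply: (@le_trans _ _ (\sum_(s <- S)
     (M%:R * Num.min (f x s) (f (x * t)%g (t^-1 * s)%g) - 1))).
    rewrite big_split /= -mulr_sumr sumrN big_const_seq count_predT iter_addr_0.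
    by have := ler_wpM2l (ltW M0) (fF x t tF); nra.
  apply: le_trans (_ : (\sum_(s <- S) k s)%:R <= _); last first.
    by rewrite -(card_col x) ler_nat fsubset_leq_card.
  rewrite natr_sum; apply: ler_sum => s _; rewrite lerBlDr natr1 /k.
  rewrite minr_pMr ?(ltW M0) // /c /minn.
  case: ifP => _; last first.
    by apply: ltW; apply: le_lt_trans (truncnS_gt _); rewrite ge_min lexx orbT.
  by apply: ltW; apply: le_lt_trans (truncnS_gt _); rewrite ge_min lexx.
have AI0 (x t : G) : t \in length_ball e (Num.truncn r) ->
    0 < #|` A x `&` A (x * t)%g|%:R :> R.
  by move/(AI x); apply: lt_le_trans; rewrite mulr_gt0 // subr_gt0.
exists A; split.
- move=> x; have := AI0 x 1%g (length_ball1 e _).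
  by rewrite mulg1 fsetIid ltr0n cardfs_gt0.
- move=> x y; rewrite len_mdistE => /(len_le_truncn (eE := eE)).
  set t := (_^-1 * _)%g => tF.
  have <- : (x * t)%g = y by rewrite mulVKg.
  have I0 := AI0 x t tF; rewrite -cardfs_gt0 -(ltr0n R); split=> //.
  rewrite ltr_pdivrMr //.
  (* The symmetric difference has |A x| + |A y| - 2 |I| points, at most 2 M - 2 |I| <= 4 d M < eps M
     (1 - 2 d) <= eps |I|. *)
  apply: (@le_lt_trans _ _ (2 * M%:R - 2 * #|` A x `&` A (x * t)%g|%:R)).
    rewrite /fsymdiff.
    have cU := cardfsU (A x `\` A (x * t)%g) (A (x * t)%g `\` A x).
    have := cA x; rewrite -(cardfsID (A (x * t)%g)) natrD.
    have := cA (x * t)%g; rewrite -(cardfsID (A x)) fsetIC natrD.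
    have : (#|` A x `\` A (x * t)%g `|` A (x * t)%g `\` A x|%:R : R) <=
      #|` A x `\` A (x * t)%g|%:R + #|` A (x * t)%g `\` A x|%:R.
      by rewrite -natrD ler_nat cU leq_subr.
    lra.
  have := AI x t tF; nra.
- exists (\sum_(s <- S) (len eE s)%:R) => x y n.
  rewrite colP => /andP[xyS _]; rewrite len_mdistE.
  by rewrite (big_fsetD1 _ xyS) /= lerDl sumr_ge0.
Qed.

End ReiterToMetric.

Theorem corollary2p3p7 (R : realType) (K H : groupType)
    (hK : group_property_A R K) (hH : group_property_A R H) :
  (forall phi : autAction H K, group_property_A R (semidirect_prod phi)) /\
  group_property_A R (K * H)%type.
Proof.
have cKH : countable [set: K * H].
  by rewrite -setXTT; apply: countableX; [case: hK | case: hH].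
have rK := group_property_A_reiter hK; have rH := group_property_A_reiter hH.
split=> [phi|]; apply: reiter_A_group_property_A => //.
  exact: reiter_A_semidirect.
exact: reiter_A_prod.
Qed.
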